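(* For every integer $N \geq 1$ and all $x_1, \dots, x_N \in \mathbb{T}$, $$ N\sum_{\substack{k \geq 1 \\ k \text{ odd}}} \frac{8}{k^2}\left| \sum_{n=1}^{N} e^{2 \pi i k x_n}\right|^2 \leq \sum_{k=1}^{\infty} \frac{2}{k^2} \left| \sum_{n=1}^{N} e^{2 \pi i k x_n}\right|^4 + \pi^2 N^2 . $$
   Context: $\mathbb{T} = \mathbb{R}/\mathbb{Z}$ is the one-dimensional torus, identified with $[0,1]$ with endpoints glued. *)

(* Defs.v *)
From HB Require Import structures.
From mathcomp Require Import all_boot all_order all_algebra.
From mathcomp Require Import generic_quotient ring_quotient.
From mathcomp Require Import complex.
From mathcomp Require Import all_classical all_reals all_analysis.

Set Implicit Arguments.
Unset Strict Implicit.
Unset Printing Implicit Defensive.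

Import Order.TTheory GRing.Theory Num.Theory.
Import Quotient.

Local Open Scope ring_scope.
Local Open Scope complex_scope.
Local Open Scope quotient_scope.

(* The additive subgroup Z of R; [Num.int_num_subdef] is the bare predicate
   behind the qualifier [Num.int]. *)
Definition int_subgroup (R : realType) : zmodClosed R :=
  GRing.ZmodClosed.clone R (@Num.int_num_subdef R) _.

(* Despite its name, [{ideal_quot _}] only needs an additive subgroup. *)
Definition torus (R : realType) : Type := {ideal_quot (int_subgroup R)}.

HB.instance Definition _ (R : realType) := GRing.Zmodule.on (torus R).
HB.instance Definition _ (R : realType) :=
  EqQuotient.on (torus R).

Definition cexp (R : realType) (z : R[i]) : R[i] :=
  (expR (complex.Re z))%:C * (cos (complex.Im z) +i* sin (complex.Im z)).

(* The value at [x] is read off the chosen representative [repr x]; by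
   [fourier_modeE] below it does not depend on that choice. *)
Definition fourier_mode (R : realType) (k : nat) (x : torus R) : R[i] :=
  cexp ((2%:R * pi * k%:R)%:C * 'i * (repr x)%:C).

Lemma cexp_imag (R : realType) (t : R) : cexp ('i * t%:C) = cos t +i* sin t.
Proof.
rewrite /cexp; simpc.
by rewrite expR0; simpc.
Qed.

Lemma cos_sin_period_int (R : realType) (t : R) (m : int) :
  cos (t + 2 * pi * m%:~R) = cos t /\ sin (t + 2 * pi * m%:~R) = sin t.
Proof.
have P (n : nat) (u : R) :
    cos (u + 2 * pi * n%:R) = cos u /\ sin (u + 2 * pi * n%:R) = sin u.
  elim: n => [|n [IHc IHs]]; first by rewrite mulr0 addr0.
  rewrite -[n.+1%:R]natr1 mulrDr mulr1 addrA mulr_natl.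
  by rewrite cosD2pi sinD2pi -mulr_natl.
case: m => n; first exact: P.
rewrite NegzE mulrNz mulrN.
have [c s] := P n.+1 (t - 2 * pi * n.+1%:R).
by move: c s; rewrite subrK => -> ->.
Qed.

Lemma fourier_modeE (R : realType) (k : nat) (x : R) :
  fourier_mode k (\pi_(torus R) x) = cexp ((2%:R * pi * k%:R)%:C * 'i * x%:C).
Proof.
have : repr (\pi_(torus R) x) - x \is a Num.int.
  by rewrite (idealrBE (int_subgroup R)) reprK.
move=> /intrP[m hm].
have E (y : R) : (2%:R * pi * k%:R)%:C * 'i * y%:C =
    'i * (2 * pi * k%:R * y)%:C :> R[i].
  by apply/eqP; rewrite eq_complex /=; simpc.
rewrite /fourier_mode !E !cexp_imag.
have -> : repr (\pi_(torus R) x) = x + m%:~R by rewrite -hm addrC subrK.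
have [c s] := cos_sin_period_int (2 * pi * k%:R * x) (k%:Z * m).
have -> : 2 * pi * k%:R * (x + m%:~R) =
    2 * pi * k%:R * x + 2 * pi * (k%:Z * m)%:~R :> R.
  by rewrite mulrDr intrM -!mulrA.
by rewrite c s.
Qed.

(* Main.v *)
(** Write [S k] for the modulus of the [k]-th exponential sum.  For odd [k],
    [2 * (S k ^+ 2 - 2 * N) ^+ 2 >= 0] reads
    [N * (8 * S k ^+ 2) <= 2 * S k ^+ 4 + 8 * N ^+ 2].  Dividing by [k ^+ 2] and
    summing over odd [k] gives the claim, because the sum of [1 / k ^+ 2] over
    odd [k] is at most [pi ^+ 2 / 8].  The last fact comes from iterating
    [1 / sin (2 y) ^+ 2 = (1 / sin y ^+ 2 + 1 / sin (pi / 2 - y) ^+ 2) / 4]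
    from [1 / sin (pi / 4) ^+ 2 = 2], and then using [sin y <= y]. *)
Require Import Defs.
From HB Require Import structures.
From mathcomp Require Import all_boot all_order all_algebra.
From mathcomp Require Import complex.
From mathcomp Require Import all_classical all_reals all_analysis.
From mathcomp Require Import zify ring lra.

Import Order.TTheory GRing.Theory Num.Theory.
Import ComplexField.Normc.
Import numFieldNormedType.Exports.

Local Open Scope ring_scope.

Lemma sin_le_id (R : realType) (x : R) : 0 <= x -> sin x <= x.
Proof.
move=> x0.
have [|c _] := @MVT_segment R sin cos 0 x x0 (fun y _ => is_derive_sin y).
  exact/continuous_subspaceT/continuous_sin.
rewrite sin0 !subr0 => ->.
by rewrite ler_piMl// cos_le1.
Qed.

(** As [sin (pi / 2 - y) = cos y], the two fractions add up to [1 / (sin y * cos y) ^ 2], and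
    [sin y * cos y] is half of [sin (2 * y)]. *)
Lemma invr_sin2_double (R : realType) (y : R) : 0 < y < pi / 2 ->
  (sin y ^+ 2)^-1 + (sin (pi / 2 - y) ^+ 2)^-1 = 4 * (sin (2 * y) ^+ 2)^-1.
Proof.
move=> /andP[y0 ypi].
have s0 : sin y != 0 by rewrite gt_eqF// sin_gt0_pihalf ?y0.
have c0 : cos y != 0.
  rewrite gt_eqF// cos_gt0_pihalf// ypi andbT; apply: lt_trans y0.
  by rewrite oppr_lt0 divr_gt0// pi_gt0.
have -> : sin (pi / 2 - y) = cos y.
  by rewrite sinB sin_pihalf cos_pihalf mul1r mul0r subr0.
rewrite (mulr_natl y 2) sin_mulr2n -[_ *+ 2]mulr_natl.
have -> : (sin y ^+ 2)^-1 + (cos y ^+ 2)^-1 =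
    (cos y ^+ 2 + sin y ^+ 2) / (sin y ^+ 2 * cos y ^+ 2).
  by field; rewrite s0 c0.
by rewrite cos2Dsin2; field; rewrite s0 c0.
Qed.

(** The angles are the odd multiples of [pi / 2 ^ m.+2] below [pi / 2]. At the next level they split
    into pairs [y], [pi / 2 - y] whose doubles [2 * y] are the angles of level [m], so each level
    multiplies the sum by 4. *)
Lemma sum_invr_sin2_odd (R : realType) (m : nat) :
  \sum_(j < 2 ^ m) (sin ((2 * j + 1)%:R * (pi / 2 ^+ m.+2)) ^+ 2)^-1
  = 2 * 4 ^+ m :> R.
Proof.
elim: m => [|m IH].
  have half2 : pi / 2 = (pi / 4) *+ 2 :> R by rewrite -mulr_natl; field.
  have c2 : cos (pi / 4) ^+ 2 = 2^-1 :> R.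
    have := cos_mulr2n (pi / 4 : R); rewrite -half2 cos_pihalf -mulr_natl.
    by move=> h; lra.
  rewrite big_ord1 muln0 add0n mul1r expr0 mulr1.
  by rewrite -[2 ^+ 2](natrX _ 2 2) sin2cos2 c2; field.
pose t : R := pi / 2 ^+ m.+3.
(* Replacing [pi] by this multiple of [t] reduces the later claims on angles to claims on their
   coefficients. *)
have tE : 4 * 2 ^+ m.+1 * t = pi.
  rewrite /t !exprS.
  have : (2 : R) ^+ m != 0 by rewrite expf_neq0.
  by move=> h; field.
have t0 : 0 < t by rewrite divr_gt0 ?pi_gt0// exprn_gt0.
rewrite -(big_mkord xpredT
  (fun j => (sin ((2 * j + 1)%:R * t) ^+ 2)^-1)).
have dbl : (2 ^ m.+1 = 2 ^ m + 2 ^ m)%N by rewrite expnS mul2n addnn.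
rewrite (@big_cat_nat _ _ _ (2 ^ m)) //=; last by rewrite dbl leq_addr.
(* Reflecting the upper half of the indices pairs [y] with [pi / 2 - y]. *)
rewrite [X in _ + X]big_nat_rev /=.
rewrite [X in _ + X](big_addn 0 _ (2 ^ m)) dbl addnK -big_split /=.
rewrite exprS mulrCA -IH big_mkord big_distrr /=; apply: eq_bigr => j _.
have jm : (j < 2 ^ m)%N by [].
have jR : (j%:R + 1 <= 2 ^+ m :> R).
  by rewrite natr1 -natrX ler_nat.
(* After reversal and shift, the partner of [j] is its mirror image in [[0, 2 ^ m.+1)]. *)
have -> : (2 ^ m + (2 ^ m + 2 ^ m) - (j + 2 ^ m).+1 = 2 ^ m.+1 - j.+1)%N.
  by rewrite dbl addnC -addSn subnDr.
have E1 : (2 * (2 ^ m.+1 - j.+1) + 1)%:R * t = pi / 2 - (2 * j + 1)%:R * t.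
  rewrite natrD natrM natrB; last first.
    by rewrite dbl (leq_trans jm)// leq_addr.
  by rewrite natrX -tE natrD natrM -natr1; field.
rewrite E1 invr_sin2_double.
  congr (_ * (sin _ ^+ 2)^-1).
  rewrite mulrCA; congr (_ * _); rewrite /t [2 ^+ m.+3]exprS.
  by field; rewrite expf_neq0.
apply/andP; split; first by rewrite mulr_gt0// ltr0n addn1.
rewrite -tE natrD natrM exprS.
have -> : 4 * (2 * 2 ^+ m) * t / 2 = (4 * 2 ^+ m) * t by field.
by rewrite ltr_pM2r//; move: jR (ler0n R j); lra.
Qed.

(** With [t = pi / 2 ^ m.+2], the bound [sin (k * t) <= k * t] gives
    [1 / k ^ 2 <= t ^ 2 / sin (k * t) ^ 2]; the right sides add up to exactly [pi ^ 2 / 8]. *)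
Lemma sum_odd_invr2_pow2_le (R : realType) (m : nat) :
  \sum_(j < 2 ^ m) ((2 * j + 1)%:R ^+ 2)^-1 <= pi ^+ 2 / 8 :> R.
Proof.
pose t : R := pi / 2 ^+ m.+2.
have t0 : 0 < t by rewrite divr_gt0 ?pi_gt0// exprn_gt0.
have p0 : (2 : R) ^+ m != 0 by rewrite expf_neq0.
have -> : pi ^+ 2 / 8 = t ^+ 2 * (2 * 4 ^+ m).
  rewrite /t !exprS.
  have -> : (4 ^+ m = 2 ^+ m * 2 ^+ m :> R) by rewrite -exprMn -natrM.
  by field.
rewrite -sum_invr_sin2_odd big_distrr /=; apply: ler_sum => j _.
rewrite -/t; set k : R := (2 * j + 1)%:R.
have k0 : 0 < k by rewrite ltr0n addn1.
(* This makes [sin (k * t)] positive, so that its bound may be squared and inverted. *)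
have kt : 0 < k * t < pi.
  rewrite mulr_gt0//= /t mulrA ltr_pdivrMr ?exprn_gt0//.
  rewrite mulrC ltr_pM2l ?pi_gt0//.
  rewrite /k -natrX ltr_nat.
  have := ltn_ord j; rewrite !expnS; lia.
have s0 := sin_gt0_pi kt.
have /andP[kt0 _] := kt.
have : sin (k * t) ^+ 2 <= (k * t) ^+ 2.
  by rewrite ler_sqr ?nnegrE ?(ltW s0) ?(ltW kt0) ?sin_le_id ?ltW.
rewrite -lef_pV2 ?posrE ?exprn_gt0//; move=> h.
have := ler_wpM2l (ltW (exprn_gt0 2 t0)) h; apply: le_trans.
by rewrite le_eqVlt; apply/orP; left; apply/eqP; field; rewrite !gt_eqF.
Qed.

Lemma big_nat_odd (V : nmodType) (F : nat -> V) (n : nat) :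
  \sum_(1 <= k < n.*2.+1 | odd k) F k = \sum_(j < n) F (2 * j + 1)%N.
Proof.
elim: n => [|n IH]; first by rewrite big_ord0 big_geq.
rewrite doubleS big_mkcond /= 2?big_nat_recr//= -big_mkcond /= IH.
by rewrite odd_double /= addr0 big_ord_recr /= mul2n addn1.
Qed.

(** The terms are nonnegative, so the range may be enlarged until it holds [2 ^ n] odd indices. *)
Lemma sum_odd_invr2_le (R : realType) (n : nat) :
  \sum_(1 <= k < n | odd k) (k%:R ^+ 2)^-1 <= pi ^+ 2 / 8 :> R.
Proof.
apply: le_trans (sum_odd_invr2_pow2_le R n).
rewrite -(big_nat_odd _ (fun k => (k%:R ^+ 2)^-1)).
have n2 : (n <= (2 ^ n).*2.+1)%N.
  rewrite ltnW// ltnS -addnn.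
  by rewrite (leq_trans (ltnW (ltn_expl n (leqnn 2))))// leq_addr.
(* Splitting the larger range at [n] requires [1 <= n]; for [n = 0] the left sum is empty. *)
case: n n2 => [|n] n2.
  by rewrite big_geq// sumr_ge0// => k _; rewrite invr_ge0 exprn_ge0.
rewrite [leRHS](@big_cat_nat _ _ _ n.+1)//= lerDl.
by rewrite sumr_ge0// => k _; rewrite invr_ge0 exprn_ge0.
Qed.

Local Open Scope ereal_scope.

Lemma nneseries_odd_invr2_le (R : realType) (c : R) : (0 <= c)%R ->
  \sum_(1 <= k <oo | odd k) (c / k%:R ^+ 2)%R%:E <= (c * (pi ^+ 2 / 8))%R%:E.
Proof.
move=> c0; apply: lime_le.
  by apply: is_cvg_nneseries => k _ _; rewrite lee_fin divr_ge0// exprn_ge0.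
apply: nearW => n; rewrite sumEFin lee_fin -mulr_sumr.
by rewrite ler_wpM2l// sum_odd_invr2_le.
Qed.

Theorem mainTheorem5 (R : realType) (N : nat) (hN : (1 <= N)%N)
    (x : 'I_N -> torus R) :
  N%:R%:E * \sum_(1 <= k <oo | odd k)
      (8%:R / k%:R ^+ 2 *
        normc (\sum_(n < N) fourier_mode k (x n)) ^+ 2)%R%:E
  <= \sum_(1 <= k <oo)
      (2%:R / k%:R ^+ 2 *
        normc (\sum_(n < N) fourier_mode k (x n)) ^+ 4)%R%:E
     + (pi ^+ 2 * N%:R ^+ 2)%R%:E.
Proof.
pose S k : R := (normc (\sum_(n < N) fourier_mode k (x n)))%R.
have S0 k : (0 <= S k)%R.
  by rewrite /S; case: (\sum_(n < N) _)%R => a b; exact: sqrtr_ge0.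
have c0 (c k : nat) : (0 <= c%:R / k%:R ^+ 2 :> R)%R.
  by rewrite divr_ge0// exprn_ge0.
rewrite -nneseriesZl; last first.
  by move=> k _; rewrite lee_fin mulr_ge0// exprn_ge0// S0.
pose f k := (2%:R / k%:R ^+ 2 * S k ^+ 4)%R%:E.
(* The constant 8 completes the square below, and its sum over odd [k] is at most [8 * N ^ 2 * (pi ^
   2 / 8) = pi ^ 2 * N ^ 2]. *)
pose g (k : nat) := ((8 * N%:R ^+ 2) / k%:R ^+ 2 : R)%R%:E.
have f0 k : 0 <= f k by rewrite lee_fin mulr_ge0// exprn_ge0.
have g0 k : 0 <= g k by rewrite lee_fin divr_ge0// ?mulr_ge0 ?exprn_ge0.
apply: (@le_trans _ _ (\sum_(1 <= k <oo | odd k) (f k + g k))).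
  apply: lee_nneseries => [k _ _|k _]; rewrite -EFinM -/(S k).
    by rewrite lee_fin mulr_ge0// mulr_ge0// exprn_ge0.
  rewrite -EFinD lee_fin -subr_ge0.
  have -> : (2 / k%:R ^+ 2 * S k ^+ 4 + 8 * N%:R ^+ 2 / k%:R ^+ 2 -
      N%:R * (8 / k%:R ^+ 2 * S k ^+ 2) =
      2 / k%:R ^+ 2 * (S k ^+ 2 - 2 * N%:R) ^+ 2)%R by ring.
  by rewrite mulr_ge0// sqr_ge0.
rewrite nneseriesD//; apply: leeD.
  (* Restoring the even [k] only adds nonnegative terms [f k]. *)
  rewrite eseries_mkcond.
  by apply: lee_nneseries => k *; case: ifP => _ //; exact: f0.
have -> : (pi ^+ 2 * N%:R ^+ 2 = 8 * N%:R ^+ 2 * (pi ^+ 2 / 8) :> R)%R by field.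
by apply: nneseries_odd_invr2_le; rewrite mulr_ge0// exprn_ge0.
Qed.
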